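(* The generating function $G_3(x)=\sum_{n\ge0}g_{3,n}x^n$ for Greek key tours on height $3$ grid graphs is $$G_3(x)=\frac{1-x-x^2+4x^3-x^4}{(1-2x)(1-2x^2)}.$$
   Context: A Greek key tour on the $k\times n$ grid graph ($k$ rows, $n$ columns; vertices are integer points, edges join points at distance $1$) is a directed self-avoiding walk that starts at the upper-left corner vertex and visits every vertex of the grid exactly once. $g_{k,n}$ denotes the number of Greek key tours on the $k\times n$ grid graph, with the convention $g_{k,0}=1$. *)

(* Defs.v *)
From HB Require Import structures.
From mathcomp Require Import all_boot all_order all_algebra.
From mathcomp Require Import boolp.

Set Implicit Arguments.
Unset Strict Implicit.
Unset Printing Implicit Defensive.

Import GRing.Theory.
Local Open Scope ring_scope.

(* The vertex (i, j) lies in row i (counted from the top) and column j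
   (counted from the left), so the upper-left corner is (0, 0). *)
Definition grid (k n : nat) : finType := ('I_k * 'I_n)%type.

(* Euclidean distance 1 between integer points, with the distance squared. *)
Definition grid_adj (k n : nat) : rel (grid k n) :=
  fun u v => (u.1%:Z - v.1%:Z) ^+ 2 + (u.2%:Z - v.2%:Z) ^+ 2 == 1.

Definition upper_left (k n : nat) (v : grid k n) : bool :=
  (v.1 == 0%N :> nat) && (v.2 == 0%N :> nat).

Definition greek_key_tour (k n : nat) (s : seq (grid k n)) : bool :=
  [&& if s is v :: _ then upper_left v else false,
      sorted (@grid_adj k n) s, uniq s & [forall v, v \in s]].

(* Every tour visits each of the k * n vertices once, so counting the tuples
   of that length counts all tours.  For n = 0 the value is the convention
   g_{k,0} = 1, not a count. *)
Definition greek_key_number (k n : nat) : nat :=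
  if n is 0 then 1%N
  else #|[set t : (k * n).-tuple (grid k n) | greek_key_tour t]|.

(* A record rather than an alias of nat -> R, whose library ring structure is
   pointwise multiplication. *)
Record fps (R : Type) : Type := Fps { fps_coef : nat -> R }.

Lemma fps_ext (R : Type) (a b : fps R) : fps_coef a =1 fps_coef b -> a = b.
Proof. by case: a b => [f] [g] /= /funext ->. Qed.

HB.instance Definition _ (R : Type) := gen_eqMixin (fps R).
HB.instance Definition _ (R : Type) := gen_choiceMixin (fps R).

Section FpsZmodule.
Variable R : zmodType.
Implicit Types a b c : fps R.

Definition fps_zero : fps R := Fps (fun=> 0).
Definition fps_opp a : fps R := Fps (fun n => - fps_coef a n).
Definition fps_add a b : fps R := Fps (fun n => fps_coef a n + fps_coef b n).

Fact fps_addA : associative fps_add.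
Proof. by move=> a b c; apply: fps_ext => n /=; rewrite addrA. Qed.
Fact fps_addC : commutative fps_add.
Proof. by move=> a b; apply: fps_ext => n /=; rewrite addrC. Qed.
Fact fps_add0 : left_id fps_zero fps_add.
Proof. by move=> a; apply: fps_ext => n /=; rewrite add0r. Qed.
Fact fps_addN : left_inverse fps_zero fps_opp fps_add.
Proof. by move=> a; apply: fps_ext => n /=; rewrite addNr. Qed.

HB.instance Definition _ :=
  GRing.isZmodule.Build (fps R) fps_addA fps_addC fps_add0 fps_addN.
End FpsZmodule.

Section FpsRing.
Variable R : comNzRingType.
Implicit Types a b c : fps R.

Definition fps_one : fps R := Fps (fun n => (n == 0%N)%:R).
Definition fps_mul a b : fps R :=
  Fps (fun n => \sum_(i < n.+1) fps_coef a i * fps_coef b (n - i)).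

Let trunc n a : {poly R} := \poly_(i < n.+1) fps_coef a i.

Let coef_trunc n a i : (i <= n)%N -> (trunc n a)`_i = fps_coef a i.
Proof. by move=> le_in; rewrite coef_poly ltnS le_in. Qed.

Let coef_mul n a b i :
  (i <= n)%N -> fps_coef (fps_mul a b) i = (trunc n a * trunc n b)`_i.
Proof.
move=> le_in; rewrite coefM; apply: eq_bigr => j _.
have le_ji : (j <= i)%N by rewrite -ltnS.
rewrite !coef_trunc ?(leq_trans le_ji) //.
exact: leq_trans (leq_subr _ _) le_in.
Qed.

Fact fps_mulC : commutative fps_mul.
Proof.
by move=> a b; apply: fps_ext => n; rewrite !(@coef_mul n) // mulrC.
Qed.

Fact fps_mulA : associative fps_mul.
Proof.
move=> a b c; apply: fps_ext => n.
transitivity ((trunc n a * trunc n b * trunc n c)`_n).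
  rewrite -mulrA coefM; apply: eq_bigr => i _.
  by rewrite coef_trunc ?(leq_ord i) // (@coef_mul n) // leq_subr.
rewrite coefM; apply: eq_bigr => i _.
by rewrite (@coef_mul n) ?(leq_ord i) // coef_trunc // leq_subr.
Qed.

Fact fps_mul1 : left_id fps_one fps_mul.
Proof.
move=> a; apply: fps_ext => n /=.
rewrite big_ord_recl /= mul1r subn0 big1 ?addr0 // => i _.
by rewrite mul0r.
Qed.

Fact fps_mulDl : left_distributive fps_mul +%R.
Proof.
move=> a b c; apply: fps_ext => n /=.
by rewrite -big_split; apply: eq_bigr => i _; rewrite mulrDl.
Qed.

Fact fps_one_neq0 : fps_one != 0.
Proof.
apply/eqP => /(congr1 (fun a : fps R => fps_coef a 0)) /= /eqP.
by rewrite (negPf (oner_neq0 R)).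
Qed.

HB.instance Definition _ := GRing.Zmodule_isComNzRing.Build (fps R)
  fps_mulA fps_mulC fps_mul1 fps_mulDl fps_one_neq0.

Definition fpsX : fps R := Fps (fun n => (n == 1%N)%:R).

End FpsRing.

Section FpsUnitRing.
Variable R : comUnitRingType.
Implicit Types a b : fps R.

(* The first n coefficients of 1 / a, by solving a * (1 / a) = 1 degree by
   degree. *)
Fixpoint fps_inv_seq a (n : nat) : seq R :=
  if n is m.+1 then
    let s := fps_inv_seq a m in
    rcons s ((fps_coef a 0)^-1 *
             ((m == 0%N)%:R - \sum_(i < m) fps_coef a (m - i) * s`_i))
  else [::].

(* As everywhere in the library, inversion is the identity on non-units. *)
Definition fps_unit : pred (fps R) :=
  fun a => fps_coef a 0 \is a GRing.unit.
Definition fps_inv a : fps R :=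
  if fps_unit a then Fps (fun n => (fps_inv_seq a n.+1)`_n) else a.

Let size_inv_seq a n : size (fps_inv_seq a n) = n.
Proof. by elim: n => //= n IHn; rewrite size_rcons IHn. Qed.

Let nth_inv_seq a n i :
  (i < n)%N -> (fps_inv_seq a n)`_i = (fps_inv_seq a i.+1)`_i.
Proof.
elim: n => // n IHn; rewrite ltnS leq_eqVlt => /predU1P[-> // | lt_in].
by rewrite [LHS]nth_rcons size_inv_seq lt_in IHn.
Qed.

Fact fps_mulV : {in fps_unit, left_inverse 1 fps_inv *%R}.
Proof.
move=> a Ua; apply: fps_ext => n.
rewrite /fps_inv (_ : fps_unit a = true) //=.
rewrite big_ord_recr /= subnn nth_rcons size_inv_seq ltnn eqxx.
rewrite [X in _ + X]mulrC mulVKr // addrC -addrA -[RHS]addr0; congr (_ + _).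
apply/eqP; rewrite addrC subr_eq0; apply/eqP/eq_bigr => i _.
by rewrite [RHS]mulrC [in RHS]nth_inv_seq.
Qed.

Fact fps_unitP a b : b * a = 1 -> fps_unit a.
Proof.
move=> /(congr1 (fun c : fps R => fps_coef c 0)) /=.
rewrite big_ord1 subn0 => ba1; apply/unitrP.
by exists (fps_coef b 0); split; rewrite // mulrC.
Qed.

Fact fps_inv_out : {in [predC fps_unit], fps_inv =1 id}.
Proof. by move=> a nUa; rewrite /fps_inv ifN. Qed.

HB.instance Definition _ := GRing.ComNzRing_hasMulInverse.Build (fps R)
  fps_mulV fps_unitP fps_inv_out.

End FpsUnitRing.

(* The generating function \sum_n g_{k,n} x^n, an element of Z[[x]]. *)
Definition greek_key_gf (k : nat) : fps int :=
  Fps (fun n => (greek_key_number k n)%:Z).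

(* Main.v *)
Require Import Defs.
From mathcomp Require Import all_boot all_order all_algebra.
From mathcomp Require Import zify ring.
Import GRing.Theory.
Local Open Scope nat_scope.
Set Implicit Arguments.
Unset Strict Implicit.
Unset Printing Implicit Defensive.

(* A tour from the upper-left corner runs along row 0 up to some column p and
   then steps down to (1, p).  If p is not the last column, it either clears
   the left part of rows 1 and 2 and enters a fresh corner at (2, p + 1), or it
   first covers everything right of column p, comes back through the cut vertex
   (2, p + 1), and snakes through the left part.  The walks of the second kind
   start from a corner and end at the other corner of the same column; they
   obey the same decomposition and number 2^(k/2) on k + 1 columns for k even
   and 0 for k odd.  The resulting convolution for the number of tours collapses to
   s(k+1) = 2 s(k) + h(k) with h(k+2) = 2 h(k) for k > 0, hence the two factors of the
   denominator. *)

(** * Hamiltonian walks in a finite graph, weighted by their last vertex *)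

Section HamiltonianWalks.
Variables (T : finType) (e : rel T).
Implicit Types (phi : T -> nat) (U : {set T}) (v w : T).

Fixpoint saw_weight phi n U v : nat :=
  if n is n'.+1 then \sum_(w in U | e v w) saw_weight phi n' (U :\ w) w
  else phi v.

(** Taking exactly [#|U|] self-avoiding steps inside [U] forces the walk entered from [v] to exhaust
    [U]. *)
Definition ham phi U v := saw_weight phi #|U| U v.

Lemma ham0 phi v : ham phi set0 v = phi v.
Proof. by rewrite /ham cards0. Qed.

Lemma ham_step phi U v : U != set0 ->
  ham phi U v = \sum_(w in U | e v w) ham phi (U :\ w) w.
Proof.
move=> U0; rewrite /ham; have : 0 < #|U| by rewrite card_gt0.
case EU: #|U| => [//|n] _ /=; apply: eq_bigr => w /andP[wU _].
by rewrite (cardsD1 w) wU add1n in EU; case: EU => ->.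
Qed.

Lemma ham_ind (P : {set T} -> Prop) :
  (forall U, (forall w, w \in U -> P (U :\ w)) -> P U) -> forall U, P U.
Proof.
move=> IH U; have [n] := ubnP #|U|; elim: n U => [//|n IHn] U leUn.
apply: IH => w wU; apply: IHn.
by rewrite (cardsD1 w) wU add1n ltnS in leUn.
Qed.

Lemma ham_eq_weight phi psi U v : phi =1 psi -> ham phi U v = ham psi U v.
Proof.
move=> E; rewrite /ham; move: #|U| => n; elim: n U v => [|n IH] U v /=; first exact: E.
by apply: eq_bigr => w _; exact: IH.
Qed.

Lemma ham_automorphism (f : T -> T) phi U v :
    involutive f -> (forall x y, e (f x) (f y) = e x y) ->
  ham phi U (f v) = ham (phi \o f) (f @^-1: U) v.
Proof.
move=> fK fe; elim/ham_ind: U v => U IH v.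
have [->|U0] := eqVneq U set0; first by rewrite preimset0 !ham0.
rewrite !ham_step //; last first.
  have /set0Pn[x xU] := U0; apply/set0Pn; exists (f x).
  by rewrite inE fK.
rewrite (reindex_inj (inv_inj fK)) /=; apply: eq_big => [w|w /andP[wU _]].
  by rewrite inE fe.
rewrite IH //; congr (ham _ _ _); apply/setP => x.
by rewrite !inE (inj_eq (inv_inj fK)).
Qed.

(** The first step lands in [A] and no later step leaves it, so [u] is never reached. *)
Lemma ham_trap (A : pred T) phi U v u :
    u \in U -> ~~ A u -> (forall x, x \in U -> e v x -> A x) ->
    (forall x y, x \in U -> y \in U -> A x -> e x y -> A y) ->
  ham phi U v = 0.
Proof.
elim/ham_ind: U v => U IH v uU Au vA clA.
rewrite ham_step; last by apply/set0Pn; exists u.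
apply: big1 => w /andP[wU evw]; have Aw := vA _ wU evw.
apply: (IH _ wU) => //.
- by rewrite !inE uU andbT; apply: contraNneq Au => ->.
- by move=> x /setD1P[_ xU]; exact: clA.
- by move=> x y /setD1P[_ xU] /setD1P[_ yU]; exact: clA.
Qed.

(** No edge inside [U] crosses the border of [A]: the first step chooses a side, and the other side
    stays unvisited. *)
Lemma ham_separated (A : pred T) phi U v u u' :
    u \in U -> A u -> u' \in U -> ~~ A u' ->
    (forall x y, x \in U -> y \in U -> e x y -> A x = A y) ->
  ham phi U v = 0.
Proof.
move=> uU Au u'U Au' sepA.
rewrite ham_step; last by apply/set0Pn; exists u.
apply: big1 => w /andP[wU evw]; case Aw: (A w).
- apply: (@ham_trap A _ _ _ u') => //.
  + by rewrite !inE u'U andbT; apply: contraTneq Aw => <-.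
  + by move=> x /setD1P[_ xU] /(sepA _ _ wU xU) <-.
  + by move=> x y /setD1P[_ xU] /setD1P[_ yU] Ax /(sepA _ _ xU yU) <-.
- apply: (@ham_trap (predC A) _ _ _ u) => //=.
  + by rewrite !inE uU andbT; apply: contraFneq Aw => <-.
  + by rewrite negbK.
  + by move=> x /setD1P[_ xU] /(sepA _ _ wU xU) <-; rewrite Aw.
  + by move=> x y /setD1P[_ xU] /setD1P[_ yU] Ax /(sepA _ _ xU yU) <-.
Qed.

Lemma ham_weight0 phi U v u :
  u \in U -> (forall x, x \in U -> phi x = 0) -> ham phi U v = 0.
Proof.
elim/ham_ind: U v u => U IH v u uU phi0.
rewrite ham_step; last by apply/set0Pn; exists u.
apply: big1 => w /andP[wU _].
have [U1|/set0Pn[x xU]] := eqVneq (U :\ w) set0; first by rewrite U1 ham0 phi0.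
by apply: (IH _ wU _ x) => // y /setD1P[_ yU]; exact: phi0.
Qed.

(** The walk starts in [A], and [c] is the only passage between [A] and its complement. Since [c] is
    used once, all of [A] must be covered by the time the walk stands on [c]. *)
Lemma ham_cut (A : pred T) phi U v c t :
    c \in U -> A c -> t \in U -> ~~ A t ->
    (forall x, x \in U -> ~~ A x -> ~~ e v x) ->
    (forall x y, x \in U -> y \in U -> x != c -> A x -> e x y -> A y) ->
    (forall x y, x \in U -> y \in U -> y != c -> ~~ A x -> e x y -> ~~ A y) ->
  ham phi U v =
  ham (fun x => nat_of_bool (x == c)) [set x in U | A x] v *
  ham phi [set x in U | ~~ A x] c.
Proof.
elim/ham_ind: U v => U IH v cU Ac tU At vA sep sep'.
rewrite ham_step; last by apply/set0Pn; exists t.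
rewrite [X in X * _]ham_step; last by apply/set0Pn; exists c; rewrite inE cU.
rewrite big_distrl /= [LHS](bigID A) /= [X in _ + X]big1 ?addn0; last first.
  by move=> w /andP[/andP[wU evw] Aw]; have := vA _ wU Aw; rewrite evw.
apply: eq_big => [w|w /andP[/andP[wU evw] Aw]].
  by rewrite !inE -!andbA; case: (w \in U) => //=; rewrite andbC.
have [wc|wc] := eqVneq w c; last first.
  rewrite IH ?inE ?cU ?tU ?andbT //.
  - congr (ham _ _ _ * ham _ _ _); apply/setP => x; rewrite !inE.
    + by rewrite andbA.
    + by case: eqP => // ->; rewrite Aw wU.
  - by rewrite eq_sym.
  - by apply: contraNneq At => ->.
  - move=> x /setD1P[_ xU] Ax; apply/negP => /(sep _ _ wU xU wc Aw).
    exact/negP.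
  - by move=> x y /setD1P[_ xU] /setD1P[_ yU]; exact: sep.
  - by move=> x y /setD1P[_ xU] /setD1P[_ yU]; exact: sep'.
rewrite wc in evw * => {w wU Aw wc}.
have [S0|/set0Pn[s]] := eqVneq ([set x in U | A x] :\ c) set0.
  rewrite S0 ham0 eqxx mul1n; congr (ham _ _ _); apply/setP => x.
  move/setP/(_ x): S0; rewrite !inE; case: (eqVneq x c) => [->|_] /=.
    by rewrite Ac andbF.
  by case: (x \in U) => //= ->.
rewrite !inE => /andP[sc /andP[sU As]].
(* Here [c] is reached while [s] in [A] is still unvisited. The first factor vanishes because its
   walk can no longer end at [c], the left side because the two parts are now separated. *)
rewrite [X in X * _](_ : _ = 0); last first.
  apply: (@ham_weight0 _ _ _ s); first by rewrite !inE sc sU.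
  by move=> x /setD1P[/negPf ->].
apply: (@ham_separated A _ _ _ s t) => //.
- by rewrite !inE sc.
- by rewrite !inE tU andbT; apply: contraNneq At => ->.
- move=> x y /setD1P[xc xU] /setD1P[yc yU] exy.
  by case Ax: (A x); [rewrite (sep x y) | rewrite (negPf (sep' x y _ _ _ _ _)) ?Ax].
Qed.

Lemma sum_tuple_cons n (F : n.+1.-tuple T -> nat) :
  \sum_t F t = \sum_w \sum_(t : n.-tuple T) F [tuple of w :: t].
Proof.
rewrite pair_big /= (reindex (fun p : T * n.-tuple T => [tuple of p.1 :: p.2])) //.
exists (fun t => (thead t, [tuple of behead t])) => [[w t] _|t _] /=.
  by congr (_, _); apply: val_inj.
by rewrite -tuple_eta.
Qed.

Lemma card_saw n U v :
  #|[set t : n.-tuple T | [&& path e v t, uniq t & all (mem U) t]]| =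
  saw_weight (fun=> 1) n U v.
Proof.
rewrite cardsE -sum1_card big_mkcond /=; elim: n U v => [|n IH] U v.
  rewrite (eq_bigr (fun=> 1)) => [|t _]; last by rewrite tuple0 unfold_in.
  by rewrite sum_nat_const card_tuple expn0.
rewrite sum_tuple_cons /= [RHS]big_mkcond; apply: eq_bigr => w _.
case: ifP => [/andP[wU evw]|nw].
  rewrite -IH; apply: eq_bigr => t _; rewrite !unfold_in /= evw wU /=.
  congr (if _ then _ else _).
  rewrite -!andbA; case: path; case: uniq; rewrite ?andbF //= ?andbT.
  apply/andP/allP => [[nwt /allP tU] x xt|tU].
    by have xU : x \in U := tU _ xt; rewrite !inE xU andbT; apply: contraNneq nwt => <-.
  split; first by apply/negP => /tU; rewrite !inE eqxx.
  by apply/allP => x /tU /setD1P[].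
apply: big1 => t _; rewrite unfold_in /=.
by case: ifP => // /and3P[/andP[evw _] _ /andP[wU _]]; rewrite evw wU in nw.
Qed.

End HamiltonianWalks.

(** * Walks in the three-row grid, in natural-number coordinates *)

Definition near (i j a b : nat) : bool :=
  (i == a) && ((j == b.+1) || (b == j.+1)) ||
  (j == b) && ((i == a.+1) || (a == i.+1)).

Lemma grid_adjE k n (u v : grid k n) : grid_adj u v = near u.1 u.2 v.1 v.2.
Proof.
case: u v => [i j] [a b]; rewrite /grid_adj /near /=; move: (i : nat) (j : nat) (a : nat) (b : nat).
move=> {i j a b} i j a b.
have sq (x y : nat) : exists2 d : nat, ((x%:Z - y%:Z) ^+ 2 = (d ^ 2)%:Z)%R & d = (x - y) + (y - x).
  by exists ((x - y) + (y - x)) => //; rewrite expr2 -mulnn PoszM; nia.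
have [d -> Ed] := sq i a; have [d' -> Ed'] := sq j b; rewrite -PoszD eqz_nat -!mulnn.
(* As soon as one coordinate difference is at least 2, both sides are false; the differences 0 and 1
   remain. *)
by move: d d' Ed Ed' => [|[|d]] [|[|d']] Ed Ed'; nia.
Qed.

Section ThreeRows.
Variable n : nat.
Implicit Types (phi : nat -> nat -> nat) (P : nat -> nat -> bool).

(* The walker stands at (i, j), [P] is the region still to be visited, and
   [phi] weighs a walk by its last vertex: the constant 1 counts all walks, an
   indicator prescribes the end. *)
Definition walks phi P i j : nat :=
  ham (@grid_adj 3 n.+1) (fun v => phi v.1 v.2) [set v : grid 3 n.+1 | P v.1 v.2]
    (inord i, inord j).

(** The flag [c] says that the move stays in the grid; it guards against [0.-1 = 0] and against
    columns beyond [n]. *)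
Definition step_to phi P (c : bool) a b : nat :=
  if c && P a b then walks phi (fun a' b' => P a' b' && ~~ ((a' == a) && (b' == b))) a b
  else 0.

Lemma walks_ext phi P Q i j :
  (forall a b, a < 3 -> b <= n -> P a b = Q a b) -> walks phi P i j = walks phi Q i j.
Proof.
move=> PQ; congr (ham _ _ _ _); apply/setP => -[a b]; rewrite !inE /=.
by apply: PQ => //; rewrite -ltnS.
Qed.

Lemma walks0 phi P i j : i < 3 -> j <= n ->
  (forall a b, a < 3 -> b <= n -> P a b = false) -> walks phi P i j = phi i j.
Proof.
move=> i3 jn P0; rewrite (@walks_ext _ _ (fun _ _ => false)) // /walks.
rewrite (_ : [set _ | _] = set0); last by apply/setP => v; rewrite !inE.
by rewrite ham0 /= !inordK.
Qed.

Lemma walks_step phi P i j u1 u2 : i < 3 -> j <= n -> u1 < 3 -> u2 <= n -> P u1 u2 ->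
  walks phi P i j = step_to phi P (0 < i) i.-1 j + step_to phi P (i < 2) i.+1 j
                  + step_to phi P (0 < j) i j.-1 + step_to phi P (j < n) i j.+1.
Proof.
move=> i3 jn u3 un Pu; rewrite {1}/walks ham_step; last first.
  by apply/set0Pn; exists (inord u1, inord u2); rewrite inE /= !inordK.
set U := [set _ | _]; pose F w := ham (@grid_adj 3 n.+1) (fun v => phi v.1 v.2) (U :\ w) w.
rewrite -[LHS]/(\sum_(w in U | grid_adj _ w) F w) big_mkcond /=.
pose G (c : bool) a b (w : grid 3 n.+1) :=
  if [&& c, P w.1 w.2, w.1 == a :> nat & w.2 == b :> nat] then F w else 0.
have sumG (c : bool) a b : (c -> (a < 3) /\ (b <= n)) -> \sum_w G c a b w = step_to phi P c a b.
  rewrite /G /step_to; case: c => [/(_ isT) [a3 bn]|_]; last by rewrite big1.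
  have Ew (w : grid 3 n.+1) :
      (w.1 == a :> nat) && (w.2 == b :> nat) = (w == (inord a, inord b)).
    by case: w => w1 w2; rewrite xpair_eqE -!val_eqE /= !inordK.
  rewrite /= (bigD1 (inord a, inord b)) //= big1 ?addn0 => [|w wne]; last first.
    by rewrite Ew (negPf wne) andbF.
  rewrite !inordK // !eqxx !andbT; case: ifP => // _.
  congr (ham _ _ _ _); apply/setP => w; rewrite !inE andbC; congr (_ && ~~ _).
  by rewrite Ew.
(* A vertex is the target of at most one of the four moves, so the sum over neighbours splits into
   four one-term sums. *)
rewrite (eq_bigr (fun w => G (0 < i) i.-1 j w + G (i < 2) i.+1 j w
                  + G (0 < j) i j.-1 w + G (j < n) i j.+1 w)).
  by rewrite !big_split /= !sumG //; lia.
move=> w _; rewrite [w \in _]inE grid_adjE /= !inordK // /G /near.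
case: (P w.1 w.2) => /=; last by rewrite !andbF.
have w1 := ltn_ord w.1; have w2 := ltn_ord w.2.
move: (w.1 : nat) (w.2 : nat) w1 w2 => a b a3 bn.
move: (F w) => Fw; rewrite !(fun_if (fun x : nat => x)).
do ![case: ifP => ?] => //; lia.
Qed.

Lemma walks_separated (A : nat -> nat -> bool) phi P i j a b c d :
    a < 3 -> b <= n -> P a b -> A a b -> c < 3 -> d <= n -> P c d -> ~~ A c d ->
    (forall x y z t, x < 3 -> z < 3 -> P x y -> P z t -> near x y z t -> A x y = A z t) ->
  walks phi P i j = 0.
Proof.
move=> a3 bn Pab Aab c3 dn Pcd Acd sep.
apply: (@ham_separated _ _ (fun v : grid 3 n.+1 => A v.1 v.2) _ _ _ (inord a, inord b) (inord c, inord d)).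
- by rewrite inE /= !inordK.
- by rewrite /= !inordK.
- by rewrite inE /= !inordK.
- by rewrite /= !inordK.
- by move=> x y; rewrite !inE grid_adjE; apply: sep.
Qed.

Lemma walks_weight0 phi P i j a b :
    a < 3 -> b <= n -> P a b -> (forall x y, P x y -> phi x y = 0) ->
  walks phi P i j = 0.
Proof.
move=> a3 bn Pab phi0; apply: (@ham_weight0 _ _ _ _ _ (inord a, inord b)).
  by rewrite inE /= !inordK.
by move=> x; rewrite inE; exact: phi0.
Qed.

Definition at_end c d : nat -> nat -> nat := fun a b => nat_of_bool ((a == c) && (b == d)).

Lemma walks_cut (A : nat -> nat -> bool) phi P i j c d a b :
    i < 3 -> j <= n ->
    c < 3 -> d <= n -> P c d -> A c d -> a < 3 -> b <= n -> P a b -> ~~ A a b ->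
    (forall x y, x < 3 -> P x y -> ~~ A x y -> ~~ near i j x y) ->
    (forall x y z t, x < 3 -> z < 3 -> P x y -> P z t -> ~~ ((x == c) && (y == d)) -> A x y -> near x y z t -> A z t) ->
    (forall x y z t, x < 3 -> z < 3 -> P x y -> P z t -> ~~ ((z == c) && (t == d)) -> ~~ A x y -> near x y z t -> ~~ A z t) ->
  walks phi P i j = walks (at_end c d) (fun x y => P x y && A x y) i j *
                    walks phi (fun x y => P x y && ~~ A x y) c d.
Proof.
move=> i3 jn c3 dn Pcd Acd a3 bn Pab Aab iA sep sep'.
have Ecd (x : grid 3 n.+1) : (x == (inord c, inord d)) = (x.1 == c :> nat) && (x.2 == d :> nat).
  by case: x => x1 x2; rewrite xpair_eqE -!val_eqE /= !inordK.
rewrite /walks (@ham_cut _ _ (fun v : grid 3 n.+1 => A v.1 v.2) _ _ _ (inord c, inord d) (inord a, inord b)).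
- congr (_ * _).
    rewrite (@ham_eq_weight _ _ _ (fun v : grid 3 n.+1 => at_end c d v.1 v.2)).
      by congr (ham _ _ _ _); apply/setP => x; rewrite !inE.
    by move=> x; rewrite Ecd.
  by congr (ham _ _ _ _); apply/setP => x; rewrite !inE.
- by rewrite inE /= !inordK.
- by rewrite /= !inordK.
- by rewrite inE /= !inordK.
- by rewrite /= !inordK.
- by move=> x; rewrite !inE grid_adjE /= !inordK //; apply: iA.
- by move=> x y; rewrite !inE Ecd grid_adjE; apply: sep.
- by move=> x y; rewrite !inE Ecd grid_adjE; apply: sep'.
Qed.

(** The reflection exchanging rows 0 and 2 lets a walk that enters a block at its bottom corner be
    treated as one that starts at the top corner. *)
Lemma walks_flip phi P i j : i < 3 ->
  walks phi P (2 - i) j = walks (fun a b => phi (2 - a) b) (fun a b => P (2 - a) b) i j.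
Proof.
move=> i3; rewrite /walks.
pose f (v : grid 3 n.+1) : grid 3 n.+1 := (rev_ord v.1, v.2).
have -> : (inord (2 - i), inord j) = f (inord i, inord j).
  by congr (_, _); apply: val_inj; rewrite /= !inordK; lia.
rewrite (@ham_automorphism _ _ f).
- rewrite (@ham_eq_weight _ _ _ (fun v : grid 3 n.+1 => phi (2 - v.1) v.2)) //.
  by congr (ham _ _ _ _); apply/setP => x; rewrite !inE.
- by move=> [v1 v2]; rewrite /f /= rev_ordK.
- move=> [v1 v2] [w1 w2]; rewrite !grid_adjE /near /=.
  by have := ltn_ord v1; have := ltn_ord w1; lia.
Qed.

End ThreeRows.

(** * Forced moves and decompositions of the regions left to visit *)

Section Regions.
Variable n : nat.
Implicit Types (phi : nat -> nat -> nat) (P : nat -> nat -> bool).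
Local Notation walks := (walks n).
Local Notation step_to := (step_to n).

(** The moves are up, down, left and right, each evaluated in a goal of its own; [(u1, u2)]
    witnesses that the walk is not over. *)
Lemma walks_moves u1 u2 x1 x2 x3 x4 phi P i j :
    i < 3 -> j <= n -> [&& u1 < 3, u2 <= n & P u1 u2] ->
    step_to phi P (0 < i) i.-1 j = x1 -> step_to phi P (i < 2) i.+1 j = x2 ->
    step_to phi P (0 < j) i j.-1 = x3 -> step_to phi P (j < n) i j.+1 = x4 ->
  walks phi P i j = x1 + x2 + x3 + x4.
Proof. by move=> i3 jn /and3P[u3 un Pu] <- <- <- <-; exact: walks_step Pu. Qed.

Lemma step_to_no phi P (c : bool) a b : c && P a b = false -> step_to phi P c a b = 0.
Proof. by rewrite /step_to => ->. Qed.

Lemma step_to_yes Q phi P (c : bool) a b : c && P a b ->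
    (forall x y, x < 3 -> y <= n -> P x y && ~~ ((x == a) && (y == b)) = Q x y) ->
  step_to phi P c a b = walks phi Q a b.
Proof. by rewrite /step_to => -> PQ; exact: walks_ext. Qed.

Ltac no := apply: step_to_no; lia.

Lemma walks_straight phi r p q : r < 3 -> q <= p <= n ->
  walks phi (fun a b => (a == r) && (q < b <= p)) r q = phi r p.
Proof.
move=> r3; move Ed : (p - q) => d; elim: d q Ed => [|d IH] q Ed /andP[qp pn].
  by have -> : q = p by [lia]; rewrite walks0 //; lia.
rewrite (@walks_moves r p 0 0 0 (phi r p)); try lia; try no.
rewrite -(IH q.+1); try lia.
by apply: step_to_yes; lia.
Qed.

(** Once row 0 is used up, [3 - r] is the other lower row, and a variable [r] treats both
    orientations at once. *)
Lemma walks_moves_low u1 u2 x1 x2 x3 phi P r j :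
    0 < r < 3 -> j <= n -> (forall b, P 0 b = false) ->
    [&& u1 < 3, u2 <= n & P u1 u2] -> step_to phi P true (3 - r) j = x1 ->
    step_to phi P (0 < j) r j.-1 = x2 -> step_to phi P (j < n) r j.+1 = x3 ->
  walks phi P r j = x1 + x2 + x3.
Proof.
move=> r3 jn P0 Pu; have [->|->] : r = 1 \/ r = 2 by [lia];
  move=> E1 E2 E3.
- rewrite (@walks_moves u1 u2 0 x1 x2 x3) //; apply: step_to_no.
  by rewrite /= P0.
- rewrite (@walks_moves u1 u2 x1 0 x2 x3) ?addn0 //; exact: step_to_no.
Qed.

(** The walk is forced: changing rows at a column [q > c] would separate the columns left of [q]
    from those right of it. *)
Lemma walks_there_and_back phi r c p q : 0 < r < 3 -> c <= q < p -> p <= n ->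
  walks phi (fun a b => (a == r) && (c <= b < q) || (a == 3 - r) && (c <= b <= p)) r q
  = phi (3 - r) p.
Proof.
move=> r3; move Ed : (q - c) => d; elim: d q Ed => [|d IH] q Ed /andP[cq qp] pn.
  rewrite (@walks_moves_low (3 - r) p (phi (3 - r) p) 0 0); try lia; try no.
  rewrite -(@walks_straight phi (3 - r) p q); try lia.
  by apply: step_to_yes; lia.
rewrite (@walks_moves_low (3 - r) p 0 (phi (3 - r) p) 0); try lia; try no.
- rewrite (step_to_yes _ _ (fun _ _ _ _ => erefl)); last by lia.
  by apply: (@walks_separated _ (fun _ b => b < q) _ _ _ _ r c (3 - r) p); rewrite /near; lia.
- rewrite -(IH q.-1); try lia.
  by apply: step_to_yes; lia.
Qed.

(** The walker stands just to the right of the block, which is empty when [p = c]; in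
    [two_rows_corner] it stands on the last column of the block. *)
Definition two_rows_enter phi r c p :=
  walks phi (fun a b => (0 < a) && (c <= b < p)) r p.

Definition two_rows_corner phi r c p :=
  walks phi (fun a b => (0 < a) && ((c <= b < p) || (a == 3 - r) && (b == p))) r p.

Lemma two_rows_enterE phi r c p : 0 < r < 3 -> c <= p <= n ->
  two_rows_enter phi r c p =
  if p == c then phi r p else two_rows_corner phi r c p.-1.
Proof.
move=> r3 cpn; case: eqP => pc; first by rewrite /two_rows_enter walks0 //; lia.
rewrite /two_rows_enter (@walks_moves r c 0 0 (two_rows_corner phi r c p.-1) 0);
  try lia; try no.
by apply: step_to_yes; lia.
Qed.

(** Either the walk changes rows at once and finishes column [p], or it runs left to column [c] and
    returns along the other row to column [p]. *)
Lemma two_rows_cornerE phi r c p : 0 < r < 3 -> c <= p <= n ->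
  two_rows_corner phi r c p =
  two_rows_enter phi (3 - r) c p + (c < p) * phi (3 - r) p.
Proof.
move=> r3 cpn; rewrite /two_rows_corner.
rewrite (@walks_moves_low (3 - r) p (two_rows_enter phi (3 - r) c p)
  ((c < p) * phi (3 - r) p) 0); try lia; try no.
- by apply: step_to_yes; lia.
- case: (ltnP c p) => cp; last by rewrite mul0n; no.
  rewrite mul1n -(@walks_there_and_back _ _ c p p.-1); try lia.
  by apply: step_to_yes; lia.
Qed.

(** The grid is cut down to the columns [c] to [n], and the run along row 0 has covered columns [c]
    to [p]. *)
Definition top_row phi c p :=
  walks phi (fun a b => (a == 0) && (p < b) || (0 < a) && (c <= b)) 0 p.

Definition turn_down phi c p :=
  walks phi (fun a b => (a == 0) && (p < b) ||
    [&& 0 < a, c <= b & ~~ ((a == 1) && (b == p))]) 1 p.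

(** The excursion to the right from [(1, q - 1)]: it enters at [(1, q)] and must finish at [(2, q)]
    in order to come back. *)
Definition to_bottom q :=
  walks (at_end 2 q) (fun a b => (q <= b) && ~~ ((a == 1) && (b == q))) 1 q.

Definition flip phi : nat -> nat -> nat := fun a b => phi (2 - a) b.

Lemma top_rowE phi c p : c <= p <= n ->
  top_row phi c p = turn_down phi c p + (if p < n then top_row phi c p.+1 else 0).
Proof.
move=> cpn; rewrite {1}/top_row.
rewrite (@walks_moves 1 p 0 (turn_down phi c p) 0
  (if p < n then top_row phi c p.+1 else 0)); try lia; try no.
- by apply: step_to_yes; lia.
- case: ifP => pn; last by no.
  by apply: step_to_yes; lia.
Qed.

Lemma turn_down_last phi c : c <= n -> turn_down phi c n = two_rows_corner phi 1 c n.
Proof. by move=> cn; apply: walks_ext; lia. Qed.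

Lemma walks_bottom_row phi p q : q <= p < n ->
  walks phi (fun a b => (p < b) || (a == 2) && (q < b)) 2 q =
  top_row (flip phi) p.+1 p.+1.
Proof.
move Ed : (p - q) => d; elim: d q Ed => [|d IH] q Ed /andP[qp pn].
  have {Ed qp} -> : q = p by lia.
  rewrite (@walks_moves 2 n 0 0 0 (top_row (flip phi) p.+1 p.+1)); try lia; try no.
  rewrite (step_to_yes _ _ (fun _ _ _ _ => erefl)); last by lia.
  rewrite (@walks_flip _ _ _ 0) //; apply: walks_ext; lia.
rewrite (@walks_moves 2 p 0 0 0 (top_row (flip phi) p.+1 p.+1)); try lia; try no.
rewrite -(IH q.+1); try lia.
by apply: step_to_yes; lia.
Qed.

(** Going down before column [c] would strand the columns on the left. So the walk clears row 1,
    returns along row 2 and enters the fresh block at its bottom corner. *)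
Lemma walks_back_left phi c p q : c <= q < p -> p < n ->
  walks phi (fun a b => (p < b) || (c <= b) && ((a == 2) || (a == 1) && (b < q))) 1 q =
  top_row (flip phi) p.+1 p.+1.
Proof.
move Ed : (q - c) => d; elim: d q Ed => [|d IH] q Ed /andP[cq qp] pn.
  rewrite (@walks_moves 2 p 0 (top_row (flip phi) p.+1 p.+1) 0 0); try lia; try no.
  rewrite -(@walks_bottom_row _ _ q); try lia.
  by apply: step_to_yes; lia.
rewrite (@walks_moves 2 p 0 0 (top_row (flip phi) p.+1 p.+1) 0); try lia; try no.
- rewrite (step_to_yes _ _ (fun _ _ _ _ => erefl)); last by lia.
  by apply: (@walks_separated _ (fun _ b => b < q) _ _ _ _ 1 c 2 p); rewrite /near; lia.
- rewrite -(IH q.-1); try lia.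
  by apply: step_to_yes; lia.
Qed.

(** Moving down is viable only for [p = c], moving left only for [p > c]; either way the walk is
    forced to the fresh corner [(2, p + 1)]. Moving right gives the product. *)
Lemma turn_downE phi c p : c <= p < n ->
  turn_down phi c p = top_row (flip phi) p.+1 p.+1 +
                      to_bottom p.+1 * two_rows_enter phi 2 c p.
Proof.
move=> cpn; rewrite /turn_down.
set D := to_bottom _ * _; set G := top_row _ _ _.
rewrite (@walks_moves 2 p 0 (if p == c then G else 0) (if p == c then 0 else G) D);
  try lia; try no.
- by case: eqP => _; rewrite !add0n ?addn0.
- case: eqP => pc.
    rewrite /G -(@walks_bottom_row _ _ p); try lia.
    by apply: step_to_yes; lia.
  rewrite (step_to_yes _ _ (fun _ _ _ _ => erefl)); last by lia.
  by apply: (@walks_separated _ (fun _ b => b < p) _ _ _ _ 1 c 1 n); rewrite /near; lia.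
- case: eqP => pc; first by no.
  rewrite /G -(@walks_back_left _ c _ p.-1); try lia.
  by apply: step_to_yes; lia.
- rewrite (step_to_yes _ _ (fun _ _ _ _ => erefl)); last by lia.
  (* Between columns [p] and [p + 1] only the bottom edge is still usable, so [(2, p + 1)] is a cut
     vertex. *)
  rewrite (@walks_cut _ (fun _ b => p < b) _ _ _ _ 2 p.+1 2 p); rewrite /near; try lia.
  congr (_ * _); first by apply: walks_ext; lia.
  rewrite (@walks_moves 2 p 0 0 (two_rows_enter phi 2 c p) 0); try lia; try no.
  by apply: step_to_yes; lia.
Qed.

(** Only moving up survives: the walk then enters column [q + 1] on row 0 and returns by the cut
    vertex [(2, q + 1)]. Moving down spends the prescribed end too early. *)
Lemma to_bottomE q : q <= n ->
  to_bottom q = if q == n then 0 else top_row (at_end 2 q.+1) q.+1 q.+1.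
Proof.
move=> qn; rewrite /to_bottom; set G := top_row _ _ _.
rewrite (@walks_moves 2 q (if q == n then 0 else G) 0 0 0); try lia; try no.
- rewrite (step_to_yes _ _ (fun _ _ _ _ => erefl)); last by lia.
  case: eqP => qn'; first by rewrite (@walks_moves 2 q 0 0 0 0); try lia; try no.
  rewrite (@walks_moves 2 q 0 0 0 G); try lia; try no.
  rewrite (step_to_yes _ _ (fun _ _ _ _ => erefl)); last by lia.
  rewrite (@walks_cut _ (fun _ b => q < b) _ _ _ _ 2 q.+1 2 q); rewrite /near; try lia.
  rewrite [X in _ * X](_ : _ = 1) ?muln1; first by apply: walks_ext; lia.
  rewrite (@walks_moves 2 q 0 0 1 0); try lia; try no.
  rewrite (step_to_yes _ _ (fun _ _ _ _ => erefl)); last by lia.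
  by rewrite walks0 /at_end; lia.
- rewrite (step_to_yes _ _ (fun _ _ _ _ => erefl)); last by lia.
  by apply: (@walks_weight0 _ _ _ _ _ 0 q); rewrite /at_end; lia.
- case: (ltnP q n) => qn'; last by no.
  rewrite (step_to_yes _ _ (fun _ _ _ _ => erefl)); last by lia.
  (* After a move right, [(0, q)] is a dead end attached to [(0, q + 1)]: the walk would have to end
     there, where the weight is 0. *)
  rewrite (@walks_cut _ (fun a b => ~~ ((a == 0) && (b == q))) _ _ _ _ 0 q.+1 0 q);
    rewrite /near; try lia.
  rewrite [X in _ * X](_ : _ = 0) ?muln0 //.
  by apply: (@walks_weight0 _ _ _ _ _ 0 q); rewrite /at_end; lia.
Qed.

End Regions.

(** * From tours as tuples to walks *)

Lemma card_hamiltonian (T : finType) (e : rel T) (v0 : T) (A : pred T) m :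
    m = #|T| -> A =1 pred1 v0 ->
  #|[set t : m.-tuple T | [&& if tval t is v :: _ then A v else false,
      sorted e t, uniq t & [forall v, v \in tval t]]]| =
  ham e (fun=> 1) [set~ v0] v0.
Proof.
move=> mT Av; have : 0 < #|T| by apply/card_gt0P; exists v0.
rewrite -mT; case: m mT => // k kT _.
have kU : #|[set~ v0]| = k by rewrite cardsC1 -kT.
rewrite cardsE -sum1_card big_mkcond /= sum_tuple_cons (bigD1 v0) //= [X in _ + X]big1; last first.
  move=> w /negPf wv; apply: big1 => t _; rewrite unfold_in /=.
  by rewrite Av /= wv.
rewrite addn0 /ham kU -card_saw cardsE -sum1_card [RHS]big_mkcond /=.
apply: eq_bigr => t _; rewrite !unfold_in /= Av /= eqxx /=.
congr (if _ then _ else _); case: path => //=.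
case ut: (uniq t); rewrite ?andbF //= andbT.
apply/andP/allP => [[v0t _] x xt | tU].
  by rewrite /= !inE; apply: contraNneq v0t => <-.
have v0t : v0 \notin tval t by apply/negP => /tU; rewrite /= !inE eqxx.
split=> //; apply/forallP => x.
(* A duplicate-free list of [#|T|] vertices exhausts the type. *)
have /subset_cardP : #|v0 :: t| = #|T| by rewrite (card_uniqP _) /= ?v0t ?ut // size_tuple.
by move=> /(_ (subset_predT _)) ->.
Qed.

Lemma greek_key_number_top_row n :
  greek_key_number 3 n.+1 = top_row n (fun _ _ => 1) 0 0.
Proof.
rewrite /greek_key_number /greek_key_tour (@card_hamiltonian _ _ (inord 0, inord 0)).
- congr (ham _ _ _ _); apply/setP => -[a b].
  by rewrite !inE xpair_eqE -!val_eqE /= !inordK //; lia.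
- by rewrite card_prod !card_ord.
- by move=> [a b]; rewrite /upper_left /= xpair_eqE -!val_eqE /= !inordK.
Qed.

(** * Values of the region counts *)

Section Counts.
Variable n : nat.
Local Notation top_row := (top_row n).
Local Notation enter := (two_rows_enter n).
Local Notation corner := (two_rows_corner n).
Local Notation to_bottom := (to_bottom n).
Local Notation one := (fun _ _ : nat => 1).

(** Here [q] is the column in which the walk leaves row 0; leaving it in the last column gives the
    separate term. *)
Lemma top_row_sum phi c p : c <= p <= n ->
  top_row phi c p =
    \sum_(p <= q < n) (top_row (flip phi) q.+1 q.+1 + to_bottom q.+1 * enter phi 2 c q)
    + corner phi 1 c n.
Proof.
move Ed : (n - p) => d; elim: d p Ed => [|d IH] p Ed cpn.
  have -> : p = n by lia.
  by rewrite big_geq // top_rowE ?ltnn ?addn0 ?turn_down_last; lia.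
rewrite top_rowE // (_ : p < n) ?IH; try lia.
rewrite turn_downE ?[RHS]addnA; try lia.
by rewrite [in RHS]big_ltn ?addnA; lia.
Qed.

Lemma corner_one r c p : 0 < r < 3 -> c <= p <= n -> corner one r c p = (p - c).+1.
Proof.
move Ed : (p - c) => d; elim: d r p Ed => [|d IH] r p Ed r3 cpn.
  rewrite two_rows_cornerE // two_rows_enterE; try lia.
  by case: eqP; lia.
rewrite two_rows_cornerE // two_rows_enterE; try lia.
by case: eqP; rewrite ?IH; lia.
Qed.

(** The maximum accounts for the empty block, which still carries one walk. *)
Lemma enter_one c p : c <= p <= n -> enter one 2 c p = maxn 1 (p - c).
Proof.
move=> cpn; rewrite two_rows_enterE //; case: eqP => [->|pc]; first by lia.
by rewrite corner_one; lia.
Qed.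

(** A there-and-back finish never ends in column [c], so only the zigzag counts, and parity decides
    in which row it ends. *)
Lemma corner_at_end r c p : 0 < r < 3 -> c <= p <= n ->
  corner (at_end 2 c) r c p = (odd (p - c) == (r == 2)).
Proof.
move Ed : (p - c) => d; elim: d r p Ed => [|d IH] r p Ed r3 cpn.
  rewrite two_rows_cornerE // two_rows_enterE; try lia.
  by rewrite /at_end; case: eqP; lia.
rewrite two_rows_cornerE // two_rows_enterE; try lia.
rewrite /at_end; case: eqP => pc; first by lia.
by rewrite IH /=; lia.
Qed.

Lemma enter_at_end c p : c <= p <= n -> enter (at_end 2 c) 2 c p = ~~ odd (p - c).
Proof.
move=> cpn; rewrite two_rows_enterE //; case: eqP => [->|pc].
  by rewrite /at_end subnn !eqxx.
by rewrite corner_at_end; lia.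
Qed.

Lemma top_row_flip_at_end c q : c < q <= n -> top_row (flip (at_end 2 c)) q q = 0.
Proof.
move=> cqn; apply: (@walks_weight0 _ _ _ _ _ 1 q); rewrite /flip /at_end; lia.
Qed.

Lemma top_row_at_end_sum c : c <= n ->
  top_row (at_end 2 c) c c =
  \sum_(c <= q < n) to_bottom q.+1 * ~~ odd (q - c) + ~~ odd (n - c).
Proof.
move=> cn; rewrite top_row_sum ?leqnn // corner_at_end; try lia.
congr (_ + _); last by case: odd.
rewrite big_nat_cond [RHS]big_nat_cond; apply: eq_bigr => q /andP[cqn _].
by rewrite top_row_flip_at_end ?enter_at_end; lia.
Qed.

(** In the sum for [c], the term [q = c] equals the count for [c + 2], the term [q = c + 1]
    vanishes, and the rest is the sum for [c + 2]. Hence two more columns double the count. *)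
Lemma top_row_at_end c : c <= n ->
  top_row (at_end 2 c) c c = ~~ odd (n - c) * 2 ^ (n - c)./2.
Proof.
have [d] := ubnP (n - c); elim: d c => // d IH c cd cn.
have [c1|c2] := leqP (n - c) 1.
  have [->|En] : c = n \/ n = c.+1 by lia.
    by rewrite top_row_at_end_sum // big_geq // subnn.
  rewrite top_row_at_end_sum // big_ltn ?big_geq ?to_bottomE; try lia.
  have E1 : n - c = 1 by lia.
  by rewrite E1 ifT; lia.
have E : n - c = (n - c.+2).+2 by lia.
rewrite top_row_at_end_sum // big_ltn ?(big_ltn (m := c.+1)); try lia.
rewrite to_bottomE ?ifF ?subnn ?subSnn ?muln1 ?muln0 /=; try lia.
rewrite add0n E /= negbK.
rewrite (eq_big_nat _ _ (F2 := fun q => to_bottom q.+1 * ~~ odd (q - c.+2))); last first.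
  by move=> q cq; congr (_ * _); lia.
rewrite -addnA -top_row_at_end_sum ?IH; try lia.
by rewrite expnS; lia.
Qed.

(* Walks from (1, q) to (2, q) covering the columns q, ..., q + k. *)
Definition bottom_count k := odd k * 2 ^ k./2.

Lemma to_bottom_count q : q <= n -> to_bottom q = bottom_count (n - q).
Proof.
move=> qn; rewrite to_bottomE // /bottom_count; case: eqP => [->|qn'].
  by rewrite subnn.
rewrite top_row_at_end; last by lia.
have -> : n - q = (n - q.+1).+1 by lia.
by rewrite /= uphalf_half; case: odd.
Qed.

End Counts.

(** * Collapsing the convolution to a linear recurrence *)

(* The index is one less than the number of columns. *)
Fixpoint tour_count k :=
  if k is k'.+1 then 2 * tour_count k' + bottom_count k' + 2 ^ (k'.-1)./2 else 1.

(** Only odd indices contribute, and such a term equals the left side so far, which therefore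
    doubles. *)
Lemma sum_bottom_count k : (\sum_(0 <= i < k) bottom_count i).+1 = 2 ^ k./2.
Proof.
elim: k => [|k IH]; first by rewrite big_geq.
rewrite big_nat_recr //= -addSn IH /bottom_count uphalf_half.
by case: odd => /=; rewrite ?add1n ?add0n ?expnS; lia.
Qed.

(** Every maximum grows by one except that for [i = k - 1], so the two sums differ by a partial sum
    of [bottom_count]. *)
Lemma sum_bottom_countS k :
  (\sum_(0 <= i < k) bottom_count i * maxn 1 (k - i)).+1 =
  \sum_(0 <= i < k) bottom_count i * maxn 1 (k.-1 - i) + 2 ^ (k.-1)./2.
Proof.
case: k => [|k]; first by rewrite !big_geq.
rewrite !big_nat_recr //= -sum_bottom_count.
rewrite [X in X + _](eq_big_nat _ _ (F2 := fun i =>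
  bottom_count i * maxn 1 (k - i) + bottom_count i)).
  by rewrite big_split /=; lia.
by move=> i ik; rewrite -[X in _ + X]muln1 -mulnDr; congr (_ * _); lia.
Qed.

(** The right side has the shape produced by [top_row_sum]; its difference between [k + 1] and [k]
    is the recursion defining [tour_count]. *)
Lemma tour_count_sum k :
  tour_count k =
  \sum_(0 <= i < k) (tour_count i + bottom_count i * maxn 1 (k.-1 - i)) + k.+1.
Proof.
elim: k => [|k IH]; first by rewrite big_geq.
have := sum_bottom_countS k; move: IH.
rewrite big_nat_recr //= !big_split /=; lia.
Qed.

Lemma top_row_tour_count n c : c <= n -> top_row n (fun _ _ => 1) c c = tour_count (n - c).
Proof.
have [d] := ubnP (n - c); elim: d c => // d IH c cd cn.
rewrite top_row_sum ?leqnn // corner_one ?leqnn ?cn // tour_count_sum; congr (_ + _).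
(* The sum is reversed so that [i = n - q - 1] indexes the fresh block to the right of column
   [q]. *)
rewrite big_nat_rev -{1}[c]add0n big_addn; apply: eq_big_nat => i ik.
rewrite /flip IH ?to_bottom_count ?enter_one; try lia.
by congr (tour_count _ + bottom_count _ * maxn 1 _); lia.
Qed.

(** Eliminates the inhomogeneous term, which doubles when [k] grows by 2. This fails at [k = 0],
    where [k.-1] truncates. *)
Lemma tour_countSSS k : 0 < k ->
  tour_count k.+3 + 4 * tour_count k = 2 * tour_count k.+2 + 2 * tour_count k.+1.
Proof.
case: k => // k _; rewrite /= /bottom_count /= !expnS.
by rewrite !uphalf_half; case: odd => /=; lia.
Qed.

(** * The identity of power series *)

Local Open Scope ring_scope.

Lemma fps_coefXM (R : comNzRingType) (a : fps R) n :
  fps_coef (fpsX R * a) n = if n is n'.+1 then fps_coef a n' else 0.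
Proof.
rewrite /=; case: n => [|n]; first by rewrite big_ord1 /= mul0r.
rewrite !big_ord_recl /= mul0r add0r mul1r big1 ?addr0 ?subn1 // => i _.
by rewrite mul0r.
Qed.

Theorem mainTheorem8 :
  let x := fpsX int in
  greek_key_gf 3 =
  (1 - x - x ^+ 2 + 4 * x ^+ 3 - x ^+ 4) / ((1 - 2 * x) * (1 - 2 * x ^+ 2)).
Proof.
(* Powers and numerals are unfolded into nested products by [y] and sums, so that [fps_coefXM] reads
   coefficients off as shifts. *)
have mul_denE (y g : fps int) : g * ((1 - 2 * y) * (1 - 2 * y ^+ 2)) =
    g - y * (g + g) - y * (y * (g + g)) + y * (y * (y * (g + g + g + g))).
  by ring.
have numE (y : fps int) : 1 - y - y ^+ 2 + 4 * y ^+ 3 - y ^+ 4 =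
    1 - y * 1 - y * (y * 1) + y * (y * (y * (1 + 1 + 1 + 1))) - y * (y * (y * (y * 1))).
  by ring.
have coefD (a b : fps int) n : fps_coef (a + b) n = fps_coef a n + fps_coef b n by [].
have coefN (a : fps int) n : fps_coef (- a) n = - fps_coef a n by [].
have coef1 n : fps_coef (1 : fps int) n = (n == 0%N)%:R by [].
have coefg n : fps_coef (greek_key_gf 3) n.+1 = (tour_count n)%:Z.
  change ((greek_key_number 3 n.+1)%:Z = (tour_count n)%:Z).
  rewrite greek_key_number_top_row.
  by rewrite top_row_tour_count ?subn0.
have coefg0 : fps_coef (greek_key_gf 3) 0 = 1 by [].
move=> x; have den_unit : (1 - 2 * x) * (1 - 2 * x ^+ 2) \is a GRing.unit.
  (* With [g = 1] the same expansion gives the constant coefficient of the denominator, which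
     decides invertibility. *)
  rewrite -[_ * _]mul1r mul_denE; set d := (X in X \is a _).
  have d0 : fps_coef d 0 = 1 by rewrite !(coefD, coefN, fps_coefXM, coef1).
  by change (fps_coef d 0 \is a GRing.unit); rewrite d0; exact: unitr1.
apply: (mulIr den_unit); rewrite divrK // mul_denE numE.
apply: fps_ext => n; rewrite !(coefD, coefN, fps_coefXM).
(* Degrees up to 4, those of the numerator, are computed. From degree 5 on the recurrence applies
   with positive index. *)
case: n => [|[|[|[|[|n]]]]]; rewrite ?(coefD, coefN, fps_coefXM, coef1, coefg, coefg0) //.
have := @tour_countSSS n.+1 isT; move: tour_count => s; lia.
Qed.
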